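(* For every infinite Tychonoff space $X$, the power $X^{2^{d(X)}}$ is not D-separable.
   Context: Tychonoff spaces are $T_1$ and completely regular; powers carry the Tychonoff product topology. $d(X)$ is the density of $X$, i.e. the minimum cardinality of a dense subset of $X$. A subset is discrete if it is discrete in its subspace topology. A space $Y$ is D-separable if for every sequence $(D_n:n\in\omega)$ of dense subspaces of $Y$ one can pick discrete sets $F_n\subset D_n$ so that $\bigcup_{n\in\omega}F_n$ is dense in $Y$. *)

(* Defs.v *)
From HB Require Import structures.
From mathcomp Require Import all_boot all_order all_algebra.
From mathcomp Require Import all_classical all_reals all_analysis.

Set Implicit Arguments.
Unset Strict Implicit.
Unset Printing Implicit Defensive.

Local Open Scope classical_set_scope.
Local Open Scope card_scope.

Lemma exists_card_min (T : Type) (P : set (set T)) : P !=set0 ->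
  exists2 A, P A & forall B, P B -> A #<= B.
Proof.
move=> [A0 PA0]; pose i0 : {A | P A} := exist _ A0 PA0.
pose good (F : set ({A | P A} -> T)) :=
  (forall f, F f -> forall i, sval i (f i)) /\
  (forall f g i, F f -> F g -> f i = g i -> f = g).
have [F [[Fin Finj] Fmax]] : exists F, good F /\ forall G, F `<` G -> ~ good G.
  apply: Zorn_bigcup => C Cgood Ctot; split=> [f [G CG Gf]|f g i].
    exact: (Cgood _ CG).1.
  move=> [G CG Gf] [H CH Hg]; have [GH|HG] := Ctot _ _ CG CH.
    by apply: (Cgood _ CH).2 => //; exact: GH.
  by apply: (Cgood _ CG).2 => //; exact: HG.
have [i Fi] : exists i, forall x, sval i x -> exists2 f, F f & f i = x.
  apply: contrapT => /forallNP noti.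
  have /choice[a aP] i : exists x, sval i x /\ forall f, F f -> f i <> x.
    have /existsNP[x /not_implyP[ix /forall2NP nx]] := noti i.
    by exists x; split=> // f Ff; case: (nx f).
  apply: (Fmax (F `|` [set a])).
    split; first by move=> f Ff; left.
    by move=> /(_ a (or_intror erefl)) Fa; exact: ((aP i0).2 _ Fa).
  split=> [f [Ff|->] j|f g j [Ff|->] [Fg|->] //].
  - exact: Fin.
  - exact: (aP j).1.
  - exact: Finj.
  - by move=> fja; have := (aP j).2 _ Ff.
  - by move=> /esym gja; have := (aP j).2 _ Fg.
exists (sval i); first exact: (svalP i).
move=> B PB; pose j : {A | P A} := exist _ B PB.
have /choice[g gP] x : exists f, sval i x -> F f /\ f i = x.
  have [/Fi[f Ff fx]|nix] := pselect (sval i x); first by exists f.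
  by exists (fun=> x) => /nix.
suff [h] : $|{injfun sval i >-> B}| by exact: inj_card_le.
apply/injfunPex; exists (fun x => g x j).
  by move=> x /gP[Fg _]; exact: (Fin _ Fg j).
move=> x y /set_mem/gP[Fx gx] /set_mem/gP[Fy gy] gxy.
by rewrite -gx -gy (Finj _ _ _ Fx Fy gxy).
Qed.

Definition min_dense (X : topologicalType) (D : set X) :=
  dense D /\ forall E : set X, dense E -> D #<= E.

Lemma min_dense_ex (X : topologicalType) : exists D : set X, min_dense D.
Proof.
have [|D dD minD] := @exists_card_min X (@dense X); last by exists D; split.
by exists setT => O O0 _; rewrite setIT.
Qed.

Definition min_dense_set (X : topologicalType) : set X :=
  sval (cid (min_dense_ex X)).

Lemma min_dense_setP (X : topologicalType) : min_dense (@min_dense_set X).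
Proof. exact: svalP. Qed.

(* d(X), a cardinal being represented by a type of that cardinality; 2^d(X) is
   then [set (density X)], the type of all subsets of [density X]. *)
Definition density (X : topologicalType) : Type := set_type (@min_dense_set X).

Definition tychonoff_space (X : topologicalType) :=
  accessible_space X /\ completely_regular_space X.

(* [subspace A] has the same carrier as [Y]; the points outside [A] are
   isolated in it by construction, so only the points of [A] matter. *)
Definition discrete_subset (Y : topologicalType) (A : set Y) :=
  forall x : subspace A, open [set x].

Lemma discrete_subsetP (Y : topologicalType) (A : set Y) :
  discrete_subset A <-> A `<=` isolated A.
Proof.
split=> [dA x Ax|iA x].
  split; first exact: mem_set.
  have /nbhs_subspace_ex : nbhs (x : subspace A) [set x].
    exact: (open_nbhs_nbhs (conj (dA x) erefl)).
  move=> /(_ Ax)[V nV VA]; exists V => //; rewrite -VA.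
  by apply: setIidl => _ ->.
have [Ax|nAx] := pselect (A x); last exact: open_subspace1out.
rewrite openE => _ ->; apply/nbhs_subspace_ex => //.
have [_ [V nV VA]] := iA _ Ax; exists V => //; rewrite VA.
by apply: setIidl => _ ->.
Qed.

Definition D_separable (Y : topologicalType) :=
  forall D : nat -> set Y, (forall n, dense (D n)) ->
  exists F : nat -> set Y,
    [/\ forall n, F n `<=` D n,
        forall n, discrete_subset (F n) &
        dense (\bigcup_n F n)].

(* Main.v *)
Require Import Defs.
From mathcomp Require Import all_boot all_order all_algebra.
From mathcomp Require Import all_classical all_reals all_analysis.

(* Write K for d(X), an infinite cardinal since X is T1 and infinite. By the
   Hewitt-Marczewski-Pondiczery argument there is a set S of size K with maps
   f_t : S -> X, for t a subset of K, whose joint image is dense in X^(2^K).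
   A sequence of subsets of S is a subset of omega * S, so these sequences can
   be enumerated, as c_t, by the coordinates t themselves. Fix a point p of X.
   For a set M of coordinates let D_n be the set of points of X^(2^K) obtained
   from the f_t by replacing, for t in M, the value of f_t by p on c_t(n).
   Density of all the D_n is a property of finite character in M, so Zorn's
   lemma gives a maximal such M. Let F_n be discrete subsets of D_n, and let t
   be the coordinate coding the sequence of the F_n. If t is in M, coordinate t
   is constantly p on the union of the F_n, which is therefore not dense. If t
   is not in M, maximality yields n and a basic open box B with B inter D_n
   contained in F_n; then F_n is dense in B, and it cannot be discrete because
   X^(2^K) is T1 without isolated points. *)

Set Implicit Arguments.
Unset Strict Implicit.
Unset Printing Implicit Defensive.

Local Open Scope classical_set_scope.

(** * Injections and comparability of cardinals *)

Lemma card_le_inj (T U : Type) (u0 : U) (A : set T) (B : set U) :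
  (A #<= B)%card -> exists2 f : T -> U, set_fun A B f & set_inj A f.
Proof. by move=> /card_leP[f]; apply/injfunPex; squash (valLR u0 f). Qed.

Lemma card_le_total (T : Type) (A B : set T) :
  (A #<= B)%card \/ (B #<= A)%card.
Proof.
have [|C [] -> minC] := @exists_card_min T [set C | C = A \/ C = B].
- by exists A; left.
- by left; apply: minC; right.
- by right; apply: minC; left.
Qed.

Lemma infinite_type_nat_inj (K : Type) :
  infinite_set [set: K] -> exists i : nat -> K, injective i.
Proof.
move=> Kinf; have [k0 _] := infinite_setN0 Kinf.
have /(card_le_inj k0)[i _ iinj] := (infiniteP _).1 Kinf.
by exists i => a b; apply: iinj; rewrite in_setE.
Qed.

(** * Pairing injections on an infinite set *)

Definition pairing_dom (K : Type) (R : set (K * K * K)) : set K :=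
  [set x | exists z, R (x, x, z)].

(** A relational injection from [A * A] to [A]; [z] may be multivalued, a value being chosen in
    [pairing_graph_fun]. The domain is read off the diagonal. *)
Definition pairing_graph (K : Type) (R : set (K * K * K)) :=
  let A := pairing_dom R in
  [/\ forall x y z, R (x, y, z) -> [/\ A x, A y & A z],
      forall x y, A x -> A y -> exists z, R (x, y, z) &
      forall x y x' y' z, R (x, y, z) -> R (x', y', z) -> x = x' /\ y = y'].

Lemma pairing_domS (K : Type) (R S : set (K * K * K)) :
  R `<=` S -> pairing_dom R `<=` pairing_dom S.
Proof. by move=> RS x [z /RS]; exists z. Qed.

Lemma pairing_graph_fun (K : Type) (k0 : K) (R : set (K * K * K)) :
  pairing_graph R -> exists r : K -> K -> K,
  [/\ forall x y, pairing_dom R x -> pairing_dom R y -> R (x, y, r x y),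
      forall x y, pairing_dom R x -> pairing_dom R y ->
        pairing_dom R (r x y) &
      forall x y x' y', pairing_dom R x -> pairing_dom R y ->
        pairing_dom R x' -> pairing_dom R y' ->
        r x y = r x' y' -> x = x' /\ y = y'].
Proof.
move=> [Rdom Rtot Rinj].
have /choice[r rP] (p : K * K) : exists z, pairing_dom R p.1 ->
    pairing_dom R p.2 -> R (p.1, p.2, z).
  have [Ap|nAp] := pselect (pairing_dom R p.1 /\ pairing_dom R p.2).
    by have [z Rz] := Rtot _ _ Ap.1 Ap.2; exists z.
  by exists k0 => A1 A2; case: nAp.
exists (fun x y => r (x, y)); split.
- by move=> x y Ax Ay; exact: (rP (x, y)).
- by move=> x y Ax Ay; have [] := Rdom _ _ _ (rP (x, y) Ax Ay).
- move=> x y x' y' Ax Ay Ax' Ay' e.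
  have := rP (x', y') Ax' Ay'; rewrite -e; apply: Rinj.
  exact: (rP (x, y)).
Qed.

Lemma nat_pairing_graph (K : Type) (i : nat -> K) : injective i ->
  pairing_graph [set (i p.1, i p.2, i (pickle p)) | p in [set: nat * nat]].
Proof.
move=> iinj; set R0 := (X in pairing_graph X).
have dom a : pairing_dom R0 (i a) by exists (i (pickle (a, a))), (a, a).
have domE x : pairing_dom R0 x -> exists a, x = i a.
  by move=> [z [[a b] _ /= [<- _ _]]]; exists a.
split=> [x y z [[a b] _ /= [<- <- <-]]|x y /domE[a ->] /domE[b ->]|].
- by split.
- by exists (i (pickle (a, b))), (a, b).
- move=> x y x' y' z [[a b] _ /= [<- <- <-]] [[c d] _ /= [<- <- /iinj]].
  by move=> /(pcan_inj pickleK)[-> ->].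
Qed.

Lemma maximal_pairing_graph (K : Type) (R0 : set (K * K * K)) :
  pairing_graph R0 -> exists R, [/\ R0 `<=` R, pairing_graph R &
    forall S, R `<` S -> ~ pairing_graph S].
Proof.
move=> gR0.
have [R [gR maxR]] : exists R, pairing_graph (R `|` R0) /\
    forall S, R `<` S -> ~ pairing_graph (S `|` R0).
  (* Adjoining [R0] to every member covers the empty chain. *)
  apply: (@Zorn_bigcup _ [set R | pairing_graph (R `|` R0)]) => C Cg Ctot.
  rewrite /=; set U := \bigcup_(X in C) X.
  (* Each clause starts from at most two triples, and these lie in a common member of the chain. *)
  have pick2 s t : (U `|` R0) s -> (U `|` R0) t -> exists G,
      [/\ G `<=` U `|` R0, pairing_graph G, G s & G t].
    have CU X : C X -> X `|` R0 `<=` U `|` R0.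
      by move=> CX; apply: setSU => x Xx; exists X.
    have U0 : R0 `<=` U `|` R0 by move=> x; right.
    move=> [[X CX Xs]|Rs] [[Y CY Yt]|Rt].
    - have [XY|YX] := Ctot _ _ CX CY.
        exists (Y `|` R0); split; [exact: CU|exact: Cg|left; exact: XY|by left].
      by exists (X `|` R0); split; [exact: CU|exact: Cg|left|left; exact: YX].
    - by exists (X `|` R0); split; [exact: CU|exact: Cg|left|right].
    - by exists (Y `|` R0); split; [exact: CU|exact: Cg|right|left].
    - by exists R0.
  split=> [x y z h|x y [z hx] [w hy]|x y x' y' z h h'].
  - have [G [GU [Gd _ _] Gh _]] := pick2 _ _ h h.
    by have [? ? ?] := Gd _ _ _ Gh; split; exact: (pairing_domS GU).
  - have [G [GU [_ Gt _] Gx Gy]] := pick2 _ _ hx hy.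
    by have [||v Gv] := Gt x y; [exists z|exists w|exists v; exact: GU].
  - have [G [_ [_ _ Gi] Gh Gh']] := pick2 _ _ h h'.
    exact: Gi Gh Gh'.
exists (R `|` R0); split=> [x||S RS gS]; [by right|by []|].
apply: (maxR S); last first.
  rewrite (_ : S `|` R0 = S)//; apply/setUidPl.
  by move=> x R0x; apply: RS.1; right.
split; first by move=> x Rx; apply: RS.1; left.
by move=> SR; apply: RS.2 => x /SR Rx; left.
Qed.

(* On a maximal pairing graph with domain [A], either [A] embeds in its
   complement and the pairing extends to [A] and a disjoint copy of it, or the
   complement embeds in [A] and the pairing transfers to all of [K]. *)
Lemma infinite_pairing (K : Type) : infinite_set [set: K] ->
  exists h : K -> K -> K,
  forall x y x' y', h x y = h x' y' -> x = x' /\ y = y'.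
Proof.
move=> Kinf; have [i iinj] := infinite_type_nat_inj Kinf.
have gR0 := nat_pairing_graph iinj; set R0 := (X in pairing_graph X) in gR0.
have [R [R0R gR maxR]] := maximal_pairing_graph gR0.
have [r [rR rA rinj]] := pairing_graph_fun (i 0) gR.
set A := pairing_dom R in rR rA rinj.
have Ai a : A (i a).
  by apply: (pairing_domS R0R); exists (i (pickle (a, a))), (a, a).
have i01 : i 0 <> i 1 by move=> /iinj.
(* [B] is injected into [A] by tagging: [i 0] for points of [A], [i 1] for the others, which [v]
   first moves into [A]. *)
have merge (B : set K) (v : K -> K) :
    (forall x, B x -> ~ A x -> A (v x)) ->
    (forall x y, B x -> B y -> ~ A x -> ~ A y -> v x = v y -> x = y) ->
    exists m, (forall x, B x -> A (m x)) /\
      forall x y, B x -> B y -> m x = m y -> x = y.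
  move=> vA vinj;
  exists (fun x => if pselect (A x) then r (i 0) x else r (i 1) (v x)).
  split=> [x Bx|x y Bx By].
    by case: pselect => Ax; apply: rA => //; exact: vA.
  case: pselect => Ax; case: pselect => Ay /rinj[]//; try exact: vA.
  - by move=> /esym.
  - by move=> _; exact: vinj.
have [/(card_le_inj (i 0))[u uA uinj]|/(card_le_inj (i 0))[v vA vinj]] :=
  card_le_total A (~` A); last first.
  have [||m [mA minj]] := merge setT v.
  - by move=> x _; exact: vA.
  - by move=> x y _ _ Ax Ay; apply: vinj; rewrite in_setE.
  exists (fun x y => r (m x) (m y)) => x y x' y' /rinj[]; try exact: mA.
  by move=> /minj -> // /minj ->.
have /choice[w wP] x : exists y, (u @` A) x -> A y /\ u y = x.
  by have [[y Ay <-]|nAx] := pselect ((u @` A) x); [exists y|exists x].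
pose B := A `|` u @` A.
have [||m [mA minj]] := merge B w.
- by move=> x [//|/wP[]].
- by move=> x y [//|/wP[_ ux]] [//|/wP[_ uy]] _ _ e; rewrite -ux -uy e.
pose R' := R `|` [set t | [/\ B t.1.1, B t.1.2, ~ (A t.1.1 /\ A t.1.2) &
                             t.2 = u (r (m t.1.1) (m t.1.2))]].
have uinj' x y : A x -> A y -> u x = u y -> x = y.
  by move=> Ax Ay; apply: uinj; rewrite in_setE.
have ruA x y : B x -> B y -> A (r (m x) (m y)).
  by move=> *; apply: rA; exact: mA.
have [Rdom Rtot Rinj] := gR.
have BR' : B `<=` pairing_dom R'.
  move=> x Bx; have [Ax|nAx] := pselect (A x).
    by have [z Rz] := Rtot _ _ Ax Ax; exists z; left.
  by exists (u (r (m x) (m x))); right; split=> // -[].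
exfalso; apply: (maxR R').
  split=> [t Rt|R'R]; first by left.
  have Bu : B (u (i 0)) by right; exists (i 0).
  by apply: (uA (i 0) (Ai 0)); exact: (pairing_domS R'R (BR' _ Bu)).
have dom' x : pairing_dom R' x -> B x.
  by move=> [z [Rz|[]]//]; left; exists z.
split=> [x y z [/Rdom[Ax Ay Az]|/= [Bx By _ ->]]|x y /dom' Bx /dom' By|].
- by split; apply: BR'; left.
- by split; apply: BR' => //; right; exists (r (m x) (m y)) => //; exact: ruA.
- have [[Ax Ay]|nA] := pselect (A x /\ A y).
    by have [z Rz] := Rtot _ _ Ax Ay; exists z; left.
  by exists (u (r (m x) (m y))); right.
- move=> x y x' y' z [Rz|/= [Bx By _ ->]] [Rz'|/= [Bx' By' _]].
  + exact: Rinj Rz Rz'.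
  + move=> zE; have [_ _] := Rdom _ _ _ Rz.
    by rewrite zE => /(uA _ (ruA _ _ Bx' By')).
  + by have [_ _] := Rdom _ _ _ Rz' => /(uA _ (ruA _ _ Bx By)).
  + move=> /(uinj' _ _ (ruA _ _ Bx By) (ruA _ _ Bx' By')).
    by move=> /rinj[]; try exact: mA; move=> /minj -> // /minj ->.
Qed.

(** * Coding finite data in an infinite set *)

Definition embeds (T U : Type) := exists f : T -> U, injective f.

Lemma embeds_prod (K T U : Type) : infinite_set [set: K] ->
  embeds T K -> embeds U K -> embeds (T * U) K.
Proof.
move=> /infinite_pairing[h hinj] [f finj] [g ginj].
exists (fun p => h (f p.1) (g p.2)) => -[a b] [c d] /=.
by move=> /hinj[/finj-> /ginj->].
Qed.

Lemma embeds_seq (K T : Type) : infinite_set [set: K] ->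
  embeds T K -> embeds (seq T) K.
Proof.
move=> Kinf [f finj]; have [i iinj] := infinite_type_nat_inj Kinf.
have [h hinj] := infinite_pairing Kinf.
(* The tags [i 0] and [i 1] tell the empty list from a nonempty one. *)
exists (foldr (fun x k => h (i 1) (h (f x) k)) (h (i 0) (i 0))).
elim=> [|x s IH] [|y t] //=.
- by move=> /hinj[/iinj].
- by move=> /hinj[/iinj].
- by move=> /hinj[_ /hinj[/finj-> /IH->]].
Qed.

Lemma embeds_code (K : Type) : infinite_set [set: K] ->
  embeds (nat * (seq K * seq (seq bool * K))) K.
Proof.
move=> Kinf; have natK : embeds nat K := infinite_type_nat_inj Kinf.
have idK : embeds K K by exists id.
have boolK : embeds bool K.
  by have [i iinj] := natK; exists (i \o nat_of_bool) => -[] [] /iinj.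
by do ![apply: embeds_prod => // | apply: embeds_seq => //].
Qed.

(** * Independent families of maps *)

(** One point of the symmetric difference for each pair of distinct members of [L] suffices. *)
Lemma separating_seq (K : Type) (k0 : K) (L : seq (set K)) :
  exists A : seq K,
  {in L &, injective (fun t : set K => [seq `[< t k >] | k <- A])}.
Proof.
have /choice[sep sepP] (p : set K * set K) : exists k,
    p.1 <> p.2 -> ~ (p.1 k <-> p.2 k).
  have [->|ne] := pselect (p.1 = p.2); first by exists k0.
  have /existsNP[k kP] : ~ forall k, p.1 k <-> p.2 k.
    by move=> e; apply: ne; apply/seteqP; split=> k /e.
  by exists k.
exists [seq sep p | p <- [seq (t, t') | t <- L, t' <- L]] => t t' tL t'L.
rewrite /= -!map_comp => /eq_in_map e.
apply: contrapT => /(sepP (t, t')); apply.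
have /e /= h : (t, t') \in [seq (t, t') | t <- L, t' <- L].
  by apply/allpairsP; exists (t, t').
by split=> /asboolP; [rewrite h|rewrite -h] => /asboolP.
Qed.

(** Density of the joint image in [X^T], tested on basic open boxes. *)
Definition independent (T : eqType) (S : Type) (X : topologicalType)
    (x : T -> S -> X) :=
  forall (L : seq T) (V : T -> set X),
    (forall t, open (V t)) -> (forall t, V t !=set0) ->
    exists s, forall t, t \in L -> V t (x t s).

(* The Hewitt-Marczewski-Pondiczery maps: a code [(A, g)] consists of a finite
   list [A] and a finite partial function [g] on the traces of sets on [A]. *)
Lemma independent_maps (K : Type) (X : topologicalType) (v : K -> X) (k0 : K) :
  dense (range v) -> exists f : set K -> seq K * seq (seq bool * K) -> X,
  independent f.
Proof.
move=> dv; pose key (A : seq K) (t : set K) := [seq `[< t k >] | k <- A].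
pose look (g : seq (seq bool * K)) w := nth k0 (unzip2 g) (index w (unzip1 g)).
exists (fun t s => v (look s.2 (key s.1 t))) => L V oV V0.
have /choice[d dP] t : exists k, V t (v k).
  by have [x [Vx [k _ kx]]] := dv _ (V0 t) (oV t); exists k; rewrite kx.
have [A Ainj] := separating_seq k0 L.
(* The code tabulates [d t] against the trace of [t] on [A]; traces separate [L], so the lookup
   returns [d t]. *)
exists (A, [seq (key A t, d t) | t <- L]) => t tL /=.
suff -> : look [seq (key A t, d t) | t <- L] (key A t) = d t by [].
rewrite /look /unzip1 /unzip2 -!map_comp /=.
rewrite [X in index _ X](_ : _ = map (key A) L)//.
have tAL : key A t \in map (key A) L by exact: map_f.
have lt_i : index (key A t) (map (key A) L) < size L.
  by rewrite -(size_map (key A)) index_mem.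
rewrite (nth_map t)//; congr d; apply: Ainj => //; first exact: mem_nth.
by rewrite -[LHS]/(key A _) -(nth_map _ [::])// nth_index.
Qed.

(** * Basic open boxes of the power *)

Lemma open_bigcap_seq (Y : topologicalType) (I : eqType) (s : seq I)
  (N : I -> set Y) : (forall i, i \in s -> open (N i)) ->
  open [set y | forall i, i \in s -> N i y].
Proof.
elim: s => [_|i s IH oN].
  by rewrite (_ : mkset _ = setT); [exact: openT|apply/seteqP; split].
rewrite (_ : mkset _ = N i `&` [set y | forall i, i \in s -> N i y]).
  apply: openI; first by apply: oN; rewrite mem_head.
  by apply: IH => j js; apply: oN; rewrite in_cons js orbT.
apply/seteqP; split=> y /= => [Ny|[Niy Ny] j].
  by split=> [|j js]; apply: Ny; rewrite in_cons ?eqxx// js orbT.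
by rewrite in_cons => /predU1P[->//|]; exact: Ny.
Qed.

Lemma open_box (T : eqType) (X : topologicalType) (L : seq T)
  (V : T -> set X) : (forall t, open (V t)) ->
  open [set y : {ptws T -> X} | forall t, t \in L -> V t (y t)].
Proof.
move=> oV.
apply: (@open_bigcap_seq {ptws T -> X} _ L (fun t => [set y | V t (y t)])).
move=> t _; apply: (proj1 (@continuousP {ptws T -> X} X (fun y => y t))) (oV t).
exact: (@proj_continuous T (fun=> X) t).
Qed.

Lemma open_sub_box (T : choiceType) (X : topologicalType)
  (O : set {ptws T -> X}) (y : {ptws T -> X}) : open O -> O y ->
  exists (L : seq T) (V : T -> set X), [/\ forall t, open (V t),
    forall t, V t (y t) &
    [set z : {ptws T -> X} | forall t, t \in L -> V t (z t)] `<=` O].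
Proof.
move=> oO Oy; have : nbhs y O by exact: open_nbhs_nbhs.
move=> [P [[Q QfinP <-] [W JW Wy] PO]].
(* [W] is a finite intersection of open cylinders, listed by [s]. *)
have [s sub sW] : exists2 s : seq (set {ptws T -> X}),
    (forall M, M \in s -> M y /\
      exists t (N : set X), open N /\ M = [set z | N (z t)]) &
    forall z, (forall M, M \in s -> M z) -> W z.
  have [L0 L0sub WE] := QfinP _ JW; exists (finmap.enum_fset L0) => [M ML|z zL].
    split; first by move: Wy; rewrite -WE; exact.
    by have /set_mem[t _ [N oN NM]] := L0sub _ ML; exists t, N.
  by rewrite -WE => M; exact: zL.
have [L [V [oV Vy LVs]]] : exists (L : seq T) (V : T -> set X),
    [/\ forall t, open (V t), forall t, V t (y t) &
    forall z : {ptws T -> X}, (forall t, t \in L -> V t (z t)) ->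
      forall M, M \in s -> M z].
  elim: s sub {sW} => [_|M s IH sub].
    by exists [::], (fun=> setT); split=> // _; exact: openT.
  have [|L [V [oV Vy LVs]]] := IH.
    by move=> M' M's; apply: sub; rewrite in_cons M's orbT.
  have [My [t [N [oN ME]]]] := sub M (mem_head _ _).
  exists (t :: L), (fun u => if u == t then V u `&` N else V u).
  split=> [u|u|z zV].
  - by case: ifP => _ //; exact: openI.
  - by case: eqP => [->|_]//; split=> //; move: My; rewrite ME.
  - move=> M'; rewrite in_cons => /predU1P[->|].
      by have := zV t (mem_head _ _); rewrite eqxx ME => -[].
    apply: LVs => u uL; have := zV u; rewrite in_cons uL orbT => /(_ isT).
    by case: ifP => _ // -[].
exists L, V; split=> // z zV; apply: PO; exists W => //.
by apply: sW => M Ms; exact: LVs zV _ Ms.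
Qed.

Definition family_point (T S : Type) (X : topologicalType) (x : T -> S -> X)
  (s : S) : {ptws T -> X} := fun t => x t s.

Lemma dense_independent (T : choiceType) (S : Type) (X : topologicalType)
  (x : T -> S -> X) : independent x -> dense (range (family_point x)).
Proof.
move=> ix O [y Oy] oO; have [L [V [oV Vy LVO]]] := open_sub_box oO Oy.
have [|s sV] := ix L V oV; first by move=> t; exists (y t).
by exists (family_point x s); split; [exact: LVO|exists s].
Qed.

(** * Maximal collapsed families *)

Definition collapse (T S : Type) (X : Type) (p : X) (f : T -> S -> X)
    (c : T -> set S) (M : set T) (t : T) (s : S) : X :=
  if pselect (M t /\ c t s) then p else f t s.

Lemma eq_collapse (T S X : Type) (p : X) (f : T -> S -> X)
  (c : T -> set S) (M M' : set T) (t : T) (s : S) :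
  (c t s -> M t <-> M' t) -> collapse p f c M t s = collapse p f c M' t s.
Proof.
rewrite /collapse => MM'; case: pselect => [[Mt ct]|nM].
  by case: pselect => // -[]; split=> //; exact/(MM' ct).
by case: pselect => // -[M't ct]; case: nM; split=> //; exact/(MM' ct).
Qed.

(* Independence of a collapsed family involves finitely many coordinates at a
   time, hence is inherited by unions of chains. *)
Lemma maximal_collapse (T : eqType) (I S : Type) (X : topologicalType)
  (p : X) (f : T -> S -> X) (c : T -> I -> set S) :
  independent f -> exists M : set T,
  (forall n, independent (collapse p f (c^~ n) M)) /\
  forall M', M `<` M' -> ~ forall n, independent (collapse p f (c^~ n) M').
Proof.
move=> indf; pose good M := forall n, independent (collapse p f (c^~ n) M).
apply: (@Zorn_bigcup T good) => C Cgood Ctot n L V oV V0.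
set U := \bigcup_(M in C) M.
(* Since [L] is finite, one member of the chain contains all of [L] that lies in [U]; [set0], where
   nothing is collapsed, serves if the chain is empty. *)
have [M [gM MU LM]] : exists M, [/\ good M, M `<=` U &
    forall t, t \in L -> U t -> M t].
  have : exists M, [/\ C M \/ M = set0, M `<=` U &
      forall t, t \in L -> U t -> M t].
    elim: L {V oV V0} => [|t L [M [CM MU LM]]].
      by exists set0; split=> //; right.
    have [[N CN Nt]|nUt] := pselect (U t); last first.
      exists M; split=> // u; rewrite in_cons => /predU1P[->//|]; exact: LM.
    have NU : N `<=` U by move=> u Nu; exists N.
    have [NM|MN] : N `<=` M \/ M `<=` N.
      by case: CM => [CM|->]; [exact: Ctot|right].
    - exists M; split=> // u; rewrite in_cons => /predU1P[-> _|].
        exact: NM.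
      exact: LM.
    - exists N; split=> //; first by left.
      move=> u; rewrite in_cons => /predU1P[->//|uL Uu]; apply: MN; exact: LM.
  move=> [M [CM MU LM]]; exists M; split=> //.
  case: CM => [/Cgood//|->] m L' V' oV' V'0.
  have [s sV] := indf L' V' oV' V'0; exists s => t tL.
  by rewrite /collapse; case: pselect => [[]//|?]; exact: sV.
have [s sV] := gM n L V oV V0; exists s => t tL.
rewrite (eq_collapse p f (M' := M)).
  exact: sV.
by move=> _; split=> [|/MU//]; exact: LM.
Qed.

(** * Discrete sets and boxes *)

Lemma exists_neq (X : Type) : infinite_set [set: X] ->
  forall p : X, exists q, q <> p.
Proof.
move=> Xinf p; apply: contrapT => /forallNP allq; apply: Xinf.
apply: (@sub_finite_set _ _ [set p]) => [q _|]; last exact: finite_set1.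
by apply: contrapT; exact: allq.
Qed.

Lemma discrete_ptws_not_dense_in_box (T : choiceType) (X : topologicalType)
  (D F : set {ptws T -> X}) (L : seq T) (V : T -> set X) :
  accessible_space X -> infinite_set [set: X] -> infinite_set [set: T] ->
  dense D -> discrete_subset F ->
  (forall t, open (V t)) -> (forall t, V t !=set0) ->
  ~ D `&` [set y : {ptws T -> X} | forall t, t \in L -> V t (y t)] `<=` F.
Proof.
move=> T1 Xinf Tinf dD /discrete_subsetP iF oV V0.
set B : set {ptws T -> X} := (X in D `&` X) => DBF.
have oB : open B by exact: open_box.
have B0 : B !=set0 by have /choice[y yV] := V0; exists y => t _.
have [y [By Dy]] := dD _ B0 oB.
have [_ [W]] := iF _ (DBF _ (conj Dy By)).
rewrite nbhsE => -[W' [oW' W'y] W'W] WF.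
have [L' [V' [oV' V'y LVW]]] := open_sub_box (openI oW' oB) (conj W'y By).
have [t tL'] : exists t, t \notin L'.
  apply: contrapT => /forallNP allL; apply: Tinf.
  apply/finite_seqP; exists L'; apply/seteqP; split=> t //= _.
  by apply: contrapT => /negP/allL.
(* [W] isolates [y] in [F]; the free coordinate [t] lets a second point of [D], different from [y]
   at [t], fall into [W] and the box. *)
pose G := [set z : {ptws T -> X} | forall u, u \in t :: L' ->
  (if u == t then ~` [set y t] else V' u) (z u)].
have oG : open G.
  apply: (@open_box T X (t :: L') (fun u => if u == t then _ else V' u)) => u.
  case: ifP => // _; apply: closed_openC.
  exact: accessible_closed_set1.
have [q qy] := exists_neq Xinf (y t).
have G0 : G !=set0.
  exists (fun u => if u == t then q else y u) => u /=.
  by case: (u == t) => // _; exact: V'y.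
have [z [Gz Dz]] := dD _ G0 oG.
have [W'z Bz] : (W' `&` B) z.
  apply: LVW => u uL'; have := Gz u; rewrite in_cons uL' orbT => /(_ isT).
  by case: eqP uL' => // ->; rewrite (negbTE tL').
have : (W `&` F) z by split; [exact: W'W|exact: DBF].
rewrite WF => zy; have := Gz t (mem_head _ _); rewrite eqxx; apply.
by rewrite /= zy.
Qed.

(** * Failure of D-separability *)

(** A finite dense set is closed in a T1 space, hence is the whole space. *)
Lemma infinite_density (X : topologicalType) : accessible_space X ->
  infinite_set [set: X] -> infinite_set [set: density X].
Proof.
move=> T1 Xinf Dfin; apply: Xinf.
have [dD _] := min_dense_setP X; set D := @min_dense_set X in dD.
have finD : finite_set D.
  have := finite_image (fun k : density X => val k) Dfin.
  apply: sub_finite_set => x Dx.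
  by exists (SigSub (mem_set Dx)).
have oDc : open (~` D).
  by apply: closed_openC; exact: (proj1 accessible_finite_set_closed T1 _ finD).
apply: sub_finite_set finD => x _; apply: contrapT => nDx.
by have [z []] := dD _ (ex_intro _ x nDx) oDc.
Qed.

Theorem theorem47 (X : topologicalType) :
  tychonoff_space X -> infinite_set [set: X] ->
  ~ D_separable (prod_topology (fun _ : set (density X) => X)).
Proof.
move=> [T1 _] Xinf sepX; have Kinf := infinite_density T1 Xinf.
pose K := density X; pose T := set K.
have Tinf : infinite_set [set: T].
  move=> Tfin; apply: Kinf; apply: (@finite_preimage _ _ setT (@set1 K)) => //.
  by move=> k l _ _ kl; have : [set k] l by rewrite kl.
have [k0 _] := infinite_setN0 Kinf; have [p _] := infinite_setN0 Xinf.
have dK : dense (range (val : K -> X)).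
  move=> O O0 oO; have [x [Ox Dx]] := (min_dense_setP X).1 _ O0 oO.
  by exists x; split=> //; exists (SigSub (mem_set Dx)).
have [f indf] := independent_maps k0 dK.
have [j jinj] := embeds_code Kinf.
pose c (t : T) n := [set s | t (j (n, s))].
have [M [indM maxM]] := maximal_collapse p c indf.
pose x n := collapse p f (c^~ n) M.
have dD n : dense (range (family_point (x n))) by exact/dense_independent/indM.
have [F [FD dF dU]] := sepX _ dD.
(* The coordinate coding the index sets of the [F n]. *)
pose t0 : T := [set k | exists n s, F n (family_point (x n) s) /\ k = j (n, s)].
have ct0 n s : c t0 n s <-> F n (family_point (x n) s).
  by split=> [[m [r [Fr /jinj[-> ->]]]]|Fs]; [|exists n, s].
have [Mt0|nMt0] := pselect (M t0).
  have oO : open [set y : {ptws T -> X} |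
      forall t, t \in [:: t0] -> (~` [set p]) (y t)].
    apply: (@open_box T X [:: t0] (fun=> ~` [set p])) => _.
    by apply: closed_openC; exact: accessible_closed_set1.
  have [|y [yO [n _ Fy]]] := dU _ _ oO.
    have [q qp] := exists_neq Xinf p.
    by exists (fun=> q) => t _.
  have [s _ sy] := FD _ _ Fy; apply: (yO t0 (mem_head _ _)).
  rewrite -sy /= /family_point /x /collapse; case: pselect => // -[].
  by split=> //; apply/ct0; rewrite sy.
apply: (maxM (M `|` [set t0])) => [|n L V oV V0].
  split=> [t Mt|sM]; first by left.
  by apply: nMt0; apply: sM; right.
(* Otherwise no point of the enlarged family lies in the box. Indices outside [c t0 n] keep their
   old point, so the old points in the box all lie in [F n]. *)
apply: contrapT => /forallNP nL.
apply: (discrete_ptws_not_dense_in_box (L := L) T1 Xinf Tinf (dD n) (dF n) oV V0).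
move=> _ [[s _ <-] sV]; apply/ct0; apply: contrapT => nct0.
apply: (nL s) => t tL.
rewrite (eq_collapse p f (M' := M)); first exact: sV.
move=> cts; split=> [[//|tt0]|Mt]; last by left.
by case: nct0; rewrite -tt0.
Qed.
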